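(* Let $n,m,l\in\mathbb{N}$ and let $F:\mathbb{P}_n\times\mathbb{P}_m\to\mathbb{P}_l$ be a function. Consider the conditions: (a) $(A,B)\mapsto\|F(A,B)\|_!$ is jointly concave for every symmetric anti-norm $\|\cdot\|_!$ on $\mathbb{M}_l^+$; (a)$'$ $(A,B)\mapsto\|F(A,B)\|_{\{k\}}$ is jointly concave for every Ky Fan $k$-anti-norm, $1\le k\le l$; (b) $(A,B)\mapsto\|F(A,B)^{-1}\|$ is jointly convex for every symmetric norm $\|\cdot\|$ on $\mathbb{M}_l$; (b)$'$ $(A,B)\mapsto\|F(A,B)^{-1}\|_{(k)}$ is jointly convex for every Ky Fan $k$-norm, $1\le k\le l$; (c) $(A,B)\mapsto\mathrm{Tr}\, f(F(A,B))$ is jointly concave for every non-decreasing concave function $f$ on $(0,\infty)$; (d) $(A,B)\mapsto\mathrm{Tr}\, f(F(A,B)^{-1})$ is jointly convex for every non-decreasing convex function $f$ on $(0,\infty)$. Then (a) $\Leftrightarrow$ (a)$'$ $\Rightarrow$ (b) $\Leftrightarrow$ (b)$'$ $\Rightarrow$ (d), and (a) $\Rightarrow$ (c) $\Rightarrow$ (d).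
   Context: $\mathbb{M}_l$: $l\times l$ complex matrices; $\mathbb{M}_l^+$: positive semidefinite ones; $\mathbb{P}_l$: positive definite ones. A symmetric norm on $\mathbb{M}_l$ is a norm with $\|UXV\|=\|X\|$ for all unitaries $U,V$. A symmetric anti-norm $\|\cdot\|_!$ on $\mathbb{M}_l^+$ is a non-negative continuous functional with $\|\lambda A\|_!=\lambda\|A\|_!$, $\|UAU^*\|_!=\|A\|_!$, $\|A+B\|_!\ge\|A\|_!+\|B\|_!$ for all $A,B\in\mathbb{M}_l^+$, $\lambda\ge0$, unitaries $U$. With $\lambda_1(A)\ge\dots\ge\lambda_l(A)$ the eigenvalues of $A\in\mathbb{M}_l^+$ with multiplicities, the Ky Fan $k$-norm is $\|A\|_{(k)}=\sum_{j=1}^k\lambda_j(A)$ and the Ky Fan $k$-anti-norm is $\|A\|_{\{k\}}=\sum_{j=1}^k\lambda_{l+1-j}(A)$. *)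

(* Defs.v *)
From HB Require Import structures.
From mathcomp Require Import all_boot all_order all_algebra.
From mathcomp Require Import reals.
From mathcomp Require Import complex.
Set Implicit Arguments.
Unset Strict Implicit.
Unset Printing Implicit Defensive.
Import Order.TTheory GRing.Theory Num.Theory.
Local Open Scope ring_scope.
Local Open Scope sesquilinear_scope.

Section Defs.
Variable R : realType.
Local Notation C := (R[i]).

Definition cR (x : R) : C := Complex x 0.

Definition cabs (a : C) : R := complex.Re `|a|.

Definition adj {p q} (M : 'M[C]_(p, q)) : 'M[C]_(q, p) := M ^t*.

Definition psdmx {p} (A : 'M[C]_p) : Prop :=
  adj A = A /\ forall v : 'cV[C]_p, 0 <= (adj v *m A *m v) 0 0.
Definition pdmx {p} (A : 'M[C]_p) : Prop :=
  adj A = A /\ forall v : 'cV[C]_p, v != 0 -> 0 < (adj v *m A *m v) 0 0.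

(* eigenvalues (with multiplicity) of a Hermitian matrix, via the spectral
   decomposition A = U^-1 diag(d) U of the library; they are real. *)
Definition eigs {p} (A : 'M[C]_p) : seq R :=
  sort (fun x y => y <= x) [seq complex.Re (spectral_diag A 0 i) | i <- enum 'I_p].
(* lambda_j(A), j = 1..p, in non-increasing order *)
Definition eigval {p} (A : 'M[C]_p) (j : nat) : R := nth 0 (eigs A) j.-1.

(* Ky Fan k-norm and k-anti-norm on M_p^+ *)
Definition kyfan_norm {p} (k : nat) (A : 'M[C]_p) : R :=
  \sum_(1 <= j < k.+1) eigval A j.
Definition kyfan_antinorm {p} (k : nat) (A : 'M[C]_p) : R :=
  \sum_(1 <= j < k.+1) eigval A (p + 1 - j).

Definition mxfun {p} (f : R -> R) (A : 'M[C]_p) : 'M[C]_p :=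
  invmx (spectralmx A) *m diag_mx (\row_i cR (f (complex.Re (spectral_diag A 0 i))))
    *m spectralmx A.

Definition symmetric_norm {p} (N : 'M[C]_p -> R) : Prop :=
  [/\ forall X, 0 <= N X,
      forall X, N X = 0 -> X = 0,
      forall (a : C) X, N (a *: X) = cabs a * N X,
      forall X Y, N (X + Y) <= N X + N Y &
      forall U V X, U \is unitarymx -> V \is unitarymx ->
        N (U *m X *m V) = N X].

Definition continuous_on_psd {p} (N : 'M[C]_p -> R) : Prop :=
  forall A, psdmx A -> forall e : R, 0 < e -> exists2 d : R, 0 < d &
    forall B, psdmx B -> (forall i j, cabs (B i j - A i j) < d) ->
      `|N B - N A| < e.

(* symmetric anti-norm on M_p^+ (only its values on M_p^+ matter) *)
Definition symmetric_antinorm {p} (N : 'M[C]_p -> R) : Prop :=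
  [/\ forall A, psdmx A -> 0 <= N A,
      continuous_on_psd N,
      forall (t : R) A, 0 <= t -> psdmx A -> N (cR t *: A) = t * N A,
      forall U A, U \is unitarymx -> psdmx A -> N (U *m A *m adj U) = N A &
      forall A B, psdmx A -> psdmx B -> N A + N B <= N (A + B)].

Definition jointly_concave {n m} (g : 'M[C]_n -> 'M[C]_m -> R) : Prop :=
  forall A1 A2 B1 B2 (t : R), pdmx A1 -> pdmx A2 -> pdmx B1 -> pdmx B2 ->
    0 <= t <= 1 ->
    t * g A1 B1 + (1 - t) * g A2 B2
      <= g (cR t *: A1 + cR (1 - t) *: A2) (cR t *: B1 + cR (1 - t) *: B2).
Definition jointly_convex {n m} (g : 'M[C]_n -> 'M[C]_m -> R) : Prop :=
  forall A1 A2 B1 B2 (t : R), pdmx A1 -> pdmx A2 -> pdmx B1 -> pdmx B2 ->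
    0 <= t <= 1 ->
    g (cR t *: A1 + cR (1 - t) *: A2) (cR t *: B1 + cR (1 - t) *: B2)
      <= t * g A1 B1 + (1 - t) * g A2 B2.

Definition nondecr_pos (f : R -> R) : Prop :=
  forall x y, 0 < x -> x <= y -> f x <= f y.
Definition concave_pos (f : R -> R) : Prop :=
  forall x y t, 0 < x -> 0 < y -> 0 <= t <= 1 ->
    t * f x + (1 - t) * f y <= f (t * x + (1 - t) * y).
Definition convex_pos (f : R -> R) : Prop :=
  forall x y t, 0 < x -> 0 < y -> 0 <= t <= 1 ->
    f (t * x + (1 - t) * y) <= t * f x + (1 - t) * f y.

(* the trace Tr f(X) (real since f(X) is Hermitian) *)
Definition trf {p} (f : R -> R) (X : 'M[C]_p) : R := complex.Re (\tr (mxfun f X)).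

End Defs.

(* Main.v *)
Require Import Defs.
From HB Require Import structures.
From mathcomp Require Import all_boot all_order all_algebra.
From mathcomp Require Import perm classical_sets reals complex.
From mathcomp Require Import lra ring zify.
Set Implicit Arguments.
Unset Strict Implicit.
Unset Printing Implicit Defensive.
Import Order.TTheory GRing.Theory Num.Theory.
Local Open Scope ring_scope.

(**
Everything reduces to sorted rows of eigenvalues.  Write [X] for the value of [F]
at a convex combination and [Y1], [Y2] for its values at the end points.
Condition (a)' says that the prefix sums of the increasing eigenvalues of [X]
dominate those of [t *: y1 + (1 - t) *: y2], where [y1] and [y2] are the increasing
eigenvalues of [Y1] and [Y2].  T-transforms then lead from this combination to a
row that lies entrywise below the eigenvalues of [X], and a symmetric, monotone,
concave function does not decrease along a T-transform.  Hence every such [phi]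
satisfies [t * phi y1 + (1 - t) * phi y2 <= phi x].  Taking [phi u] to be
[N (diag u)] for an anti-norm [N], [\sum_i f (u i)], and [- N (diag u^-1)] for a
norm [N] gives (a), (c) and (b); dually, the decreasing eigenvalues of the inverses
and symmetric, monotone, convex functions take (b)' to (b) and (d).
Conversely, Ky Fan's variational principle, a consequence of Schur's majorization
of the diagonal by the eigenvalues, makes the Ky Fan functionals symmetric
anti-norms, respectively restrictions of symmetric norms.  Finally (c) gives (d)
because [u |-> - f u^-1] is non-decreasing and concave when [f] is non-decreasing
and convex.
*)

Section PrefixSums.
Variables (R : realFieldType) (n : nat).
Implicit Types (x y z : 'rV[R]_n) (i j k : 'I_n) (q : nat) (e : R).

Definition nondecr_row x := {homo x 0 : i j / (i <= j)%N >-> i <= j}.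
Definition nonincr_row x := {homo x 0 : i j / (i <= j)%N >-> j <= i}.

Lemma nonincr_rowN x : nonincr_row x -> nondecr_row (- x).
Proof. by move=> x_decr i j le_ij; rewrite !mxE lerN2 x_decr. Qed.

Definition prefix_sum q x : R := \sum_(i < n | (i < q)%N) x 0 i.

Lemma prefix_sum_is_scalar q : scalar (prefix_sum q).
Proof.
move=> a x y; rewrite /prefix_sum mulr_sumr -big_split.
by apply: eq_bigr => i _; rewrite !mxE.
Qed.

HB.instance Definition _ q :=
  GRing.isLinear.Build R 'rV[R]_n R _ (prefix_sum q) (prefix_sum_is_scalar q).

Lemma prefix_sumS i x : prefix_sum i.+1 x = prefix_sum i x + x 0 i.
Proof.
rewrite /prefix_sum (bigD1 i) //= addrC; congr (_ + _).
by apply: eq_bigl => j; rewrite -val_eqE /=; lia.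
Qed.

Lemma prefix_sum_delta q j : prefix_sum q (delta_mx 0 j) = (j < q)%N%:R.
Proof.
rewrite /prefix_sum big_mkcond (bigD1 j) //= mxE !eqxx big1 => [|i /negPf ne_ij].
  by rewrite addr0; case: ifP.
by rewrite mxE ne_ij andbF; case: ifP.
Qed.

Definition prefix_le x y := forall q, prefix_sum q x <= prefix_sum q y.

Lemma prefix_leN x y : prefix_le x y -> prefix_le (- y) (- x).
Proof. by move=> le_xy q; rewrite !linearN lerN2 le_xy. Qed.

Lemma prefix_le_anti x y : prefix_le x y -> prefix_le y x -> x = y.
Proof.
move=> le_xy le_yx; have eq_xy q : prefix_sum q x = prefix_sum q y.
  by apply: le_anti; rewrite le_xy le_yx.
apply/rowP => i; apply: (@addrI _ (prefix_sum i x)).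
by rewrite -prefix_sumS !eq_xy prefix_sumS.
Qed.

Lemma prefix_le_bounded x y :
  (forall q, (1 <= q <= n)%N -> prefix_sum q x <= prefix_sum q y) -> prefix_le x y.
Proof.
move=> le_xy q.
have prefix_minn z : prefix_sum q z = prefix_sum (minn q n) z.
  by apply: eq_bigl => i; rewrite leq_min ltn_ord andbT.
rewrite !prefix_minn; have [->|min_gt0] := posnP (minn q n).
  by rewrite /prefix_sum !big1.
by apply: le_xy; rewrite min_gt0 geq_minr.
Qed.

(* The right side exceeds the left one by [\sum_i (c i - (i < q)) * (x i - th)], where
   the threshold [th] separates the first [q] entries of [x] from the others. *)
Lemma prefix_sum_le_weighted q x (c : 'I_n -> R) :
  nondecr_row x -> (forall i, 0 <= c i <= 1) ->
  \sum_i c i = prefix_sum q (const_mx 1) ->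
  prefix_sum q x <= \sum_i c i * x 0 i.
Proof.
move=> x_incr c01 sum_c.
have [th [th_ge th_le]] : exists th, (forall i, (i < q)%N -> x 0 i <= th) /\
    (forall i, (q <= i)%N -> th <= x 0 i).
  have [lt_qn|le_nq] := ltnP q n.
    by exists (x 0 (Ordinal lt_qn)); split=> i le_i; apply: x_incr; rewrite //= ltnW.
  exists (\sum_i `|x 0 i|); split=> i le_i.
    by apply: (le_trans (ler_norm _)); rewrite (bigD1 i) //= lerDl sumr_ge0.
  by have := leq_trans le_nq le_i; rewrite leqNgt ltn_ord.
have sum_c_th : \sum_i (c i - (i < q)%N%:R) * th = 0.
  rewrite -mulr_suml sumrB sum_c /prefix_sum big_mkcond -sumrB big1 ?mul0r // => i _.
  by rewrite mxE; case: ifP; rewrite subrr.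
rewrite -subr_ge0 -[leRHS]subr0 -[X in 0 <= _ - X]sum_c_th.
rewrite /prefix_sum [X in _ - X - _]big_mkcond.
rewrite -!sumrB; apply: sumr_ge0 => i _; have /andP[c_ge0 c_le1] := c01 i.
have [lt_iq|le_qi] /= := ltnP i q; last first.
  by rewrite !subr0 -mulrBr mulr_ge0 // subr_ge0 th_le.
rewrite (_ : _ - _ - _ = (c i - 1) * (x 0 i - th)); last by ring.
by rewrite mulr_le0 // subr_le0 ?th_ge.
Qed.

End PrefixSums.

Section TTransforms.
Variables (R : realFieldType) (n : nat).
Implicit Types (x y z w : 'rV[R]_n) (i j k : 'I_n) (t e : R).

Definition ttransform j k t z := t *: z + (1 - t) *: col_perm (tperm j k) z.

Definition transfer j k e z := z + e *: (delta_mx 0 j - delta_mx 0 k).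

Lemma transferE j k e z i :
  transfer j k e z 0 i = z 0 i + e * ((i == j)%:R - (i == k)%:R).
Proof. by rewrite !mxE. Qed.

Lemma ttransform_transfer j k e z : z 0 j < z 0 k -> 0 <= e <= z 0 k - z 0 j ->
  exists2 t, 0 <= t <= 1 & ttransform j k t z = transfer j k e z.
Proof.
move=> lt_jk /andP[e_ge0 e_le]; have gap_gt0 : 0 < z 0 k - z 0 j by rewrite subr_gt0.
exists (1 - e / (z 0 k - z 0 j)).
  by rewrite subr_ge0 gerBl ler_pdivrMr // mul1r e_le divr_ge0 // ltW.
apply/rowP => i; rewrite transferE !mxE subKr; have [->|ne_ij] := eqVneq i j.
  have [eq_jk|_] := eqVneq j k; first by rewrite eq_jk ltxx in lt_jk.
  by rewrite tpermL /=; field; lra.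
have [->|ne_ik] := eqVneq i k; first by rewrite tpermR /=; field; lra.
by rewrite tpermD 1?eq_sym //=; ring.
Qed.

Lemma prefix_le_transfer j k e x z : (j < k)%N -> prefix_le z x ->
  (forall i, (i < k)%N -> z 0 i <= x 0 i) -> 0 <= e <= x 0 j - z 0 j ->
  prefix_le (transfer j k e z) x.
Proof.
move=> lt_jk le_zx z_le /andP[e_ge0 e_le] q; have [lt_kq|le_qk] := ltnP k q.
  rewrite linearD /= scalarZ linearB /= !prefix_sum_delta lt_kq (ltn_trans lt_jk lt_kq).
  by rewrite subrr mulr0 addr0.
apply: ler_sum => i lt_iq; have lt_ik := leq_trans lt_iq le_qk.
rewrite transferE -[i == k]val_eqE (ltn_eqF lt_ik) subr0.
by have [->|_] := eqVneq i j; [rewrite mulr1; lra | rewrite mulr0 addr0 z_le].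
Qed.

Lemma prefix_le_first_excess x z : prefix_le z x -> (exists i, x 0 i < z 0 i) ->
  exists j k, [/\ (j < k)%N, z 0 j < x 0 j, x 0 k < z 0 k &
                  forall i, (i < k)%N -> z 0 i <= x 0 i].
Proof.
move=> le_zx [k0 lt_k0].
case: (@arg_minnP _ k0 [pred i | x 0 i < z 0 i] (@nat_of_ord n)) => //= k lt_k k_min.
have z_le i : (i < k)%N -> z 0 i <= x 0 i.
  by move=> lt_ik; rewrite leNgt; apply/negP => /k_min; rewrite leqNgt lt_ik.
have [/existsP[j /andP[lt_jk lt_j]]|] :=
    boolP [exists j : 'I_n, (j < k)%N && (z 0 j < x 0 j)].
  by exists j, k.
rewrite negb_exists => /forallP z_ge.
have := le_zx k.+1; rewrite leNgt !prefix_sumS ler_ltD //.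
by apply: ler_sum => i lt_ik; have := z_ge i; rewrite lt_ik -leNgt.
Qed.

Definition disagreement x z := [set i | z 0 i != x 0 i].

(* This amount is the largest for which neither entry overshoots [x], so one of them
   reaches it. *)
Lemma card_disagreement_transfer j k x z : z 0 j < x 0 j -> x 0 k < z 0 k ->
  (#|disagreement x (transfer j k (Num.min (x 0 j - z 0 j) (z 0 k - x 0 k))%R z)|
     < #|disagreement x z|)%N.
Proof.
move=> lt_j lt_k; set e := Num.min _ _.
have ne_jk : j != k by apply: contraTneq lt_j => ->; rewrite -leNgt ltW.
apply/proper_card/properP; split.
  apply/fintype.subsetP => i; rewrite !inE transferE.
  have [->|_] := eqVneq i j; first by rewrite (lt_eqF lt_j).
  have [->|_] := eqVneq i k; first by rewrite (gt_eqF lt_k).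
  by rewrite subrr mulr0 addr0.
have [le_jk|lt_kj] := leP (x 0 j - z 0 j) (z 0 k - x 0 k).
  exists j; rewrite !inE ?(lt_eqF lt_j) // transferE eqxx (negPf ne_jk).
  by rewrite /e (min_idPl le_jk) subr0 mulr1 addrC subrK eqxx.
exists k; rewrite !inE ?(gt_eqF lt_k) // transferE eqxx [k == j]eq_sym (negPf ne_jk).
by rewrite /e (min_idPr (ltW lt_kj)) sub0r mulrN1 subKr eqxx.
Qed.

Lemma prefix_le_ind (P : 'rV[R]_n -> Prop) x z :
  (forall w j k t, 0 <= t <= 1 -> P w -> P (ttransform j k t w)) ->
  nondecr_row x -> prefix_le z x -> P z ->
  exists2 w, P w & forall i, w 0 i <= x 0 i.
Proof.
move=> PT x_incr; have [d] := ubnP #|disagreement x z|.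
elim: d z => // d IHd z; rewrite ltnS => le_d le_zx Pz.
have [/forallP z_le|] := boolP [forall i, z 0 i <= x 0 i]; first by exists z.
rewrite negb_forall => /existsP[k0]; rewrite -ltNge => lt_k0.
have [j [k [lt_jk lt_j lt_k z_le]]] :=
  prefix_le_first_excess le_zx (ex_intro _ k0 lt_k0).
have le_xjk := x_incr _ _ (ltnW lt_jk).
set e := Num.min (x 0 j - z 0 j) (z 0 k - x 0 k).
have e_ge0 : 0 <= e by rewrite le_min !subr_ge0 !ltW.
have e_lej : e <= x 0 j - z 0 j by rewrite ge_min lexx.
have [t t01 tE] : exists2 t, 0 <= t <= 1 & ttransform j k t z = transfer j k e z.
  by apply: ttransform_transfer; [lra | rewrite e_ge0; lra].
apply: (IHd (transfer j k e z)); last by rewrite -tE; exact: PT.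
  exact: leq_trans (card_disagreement_transfer lt_j lt_k) le_d.
by apply: prefix_le_transfer; rewrite ?e_ge0.
Qed.

End TTransforms.

Section SymmetricConcaveFunctions.
Variables (R : realFieldType) (n : nat).
Implicit Types (x y : 'rV[R]_n) (t : R) (D : R -> Prop) (f : R -> R).
Implicit Types (phi psi : 'rV[R]_n -> R).

Definition convex_pred D :=
  forall u v t, D u -> D v -> 0 <= t <= 1 -> D (t * u + (1 - t) * v).

Definition row_in D x := forall i, D (x 0 i).

Lemma row_in_comb D x y t : convex_pred D -> row_in D x -> row_in D y ->
  0 <= t <= 1 -> row_in D (t *: x + (1 - t) *: y).
Proof. by move=> D_convex Dx Dy t01 i; rewrite !mxE; apply: D_convex. Qed.

Definition sym_incr_concave D phi :=
  [/\ forall s x, row_in D x -> phi (col_perm s x) = phi x,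
      forall x y, row_in D x -> row_in D y -> (forall i, x 0 i <= y 0 i) ->
        phi x <= phi y &
      forall x y t, row_in D x -> row_in D y -> 0 <= t <= 1 ->
        t * phi x + (1 - t) * phi y <= phi (t *: x + (1 - t) *: y)].

Definition sym_incr_convex D psi :=
  [/\ forall s x, row_in D x -> psi (col_perm s x) = psi x,
      forall x y, row_in D x -> row_in D y -> (forall i, x 0 i <= y 0 i) ->
        psi x <= psi y &
      forall x y t, row_in D x -> row_in D y -> 0 <= t <= 1 ->
        psi (t *: x + (1 - t) *: y) <= t * psi x + (1 - t) * psi y].

Lemma sym_incr_concave_prefix_le D phi x y :
  convex_pred D -> sym_incr_concave D phi -> row_in D x -> row_in D y ->
  nondecr_row x -> prefix_le y x -> phi y <= phi x.
Proof.
move=> D_convex [phi_sym phi_incr phi_concave] Dx Dy x_incr le_yx.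
pose P w := row_in D w /\ phi y <= phi w.
have [|w [Dw le_w] le_wx] := @prefix_le_ind _ _ P x y _ x_incr le_yx (conj Dy (lexx _)).
  move=> w j k t t01 [Dw le_w].
  have Dw' : row_in D (col_perm (tperm j k) w) by move=> i; rewrite mxE.
  split; first exact: row_in_comb.
  apply: (le_trans le_w); apply: le_trans (phi_concave _ _ _ Dw Dw' t01).
  by rewrite phi_sym // -mulrDl addrC subrK mul1r.
by apply: (le_trans le_w); apply: phi_incr.
Qed.

Lemma sym_incr_concave_comb D phi x y1 y2 t :
  convex_pred D -> sym_incr_concave D phi ->
  row_in D x -> row_in D y1 -> row_in D y2 -> 0 <= t <= 1 ->
  nondecr_row x -> prefix_le (t *: y1 + (1 - t) *: y2) x ->
  t * phi y1 + (1 - t) * phi y2 <= phi x.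
Proof.
move=> D_convex phi_sym_incr Dx Dy1 Dy2 t01 x_incr le_yx.
have [_ _ phi_concave] := phi_sym_incr.
apply: (le_trans (phi_concave _ _ _ Dy1 Dy2 t01)).
apply: (sym_incr_concave_prefix_le D_convex phi_sym_incr Dx _ x_incr le_yx).
exact: row_in_comb.
Qed.

Lemma sym_incr_convexN D psi : sym_incr_convex D psi ->
  sym_incr_concave (fun u => D (- u)) (fun x => - psi (- x)).
Proof.
move=> [psi_sym psi_incr psi_convex].
have DN x : row_in (fun u => D (- u)) x -> row_in D (- x).
  by move=> Dx i; rewrite mxE.
split=> [s x /DN Dx|x y /DN Dx /DN Dy le_xy|x y t /DN Dx /DN Dy t01].
- by rewrite -linearN /= psi_sym.
- by rewrite lerN2; apply: psi_incr => // i; rewrite !mxE lerN2.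
- by rewrite opprD -!scalerN !mulrN -opprD lerN2 psi_convex.
Qed.

Lemma sym_incr_convex_comb D psi x y1 y2 t :
  convex_pred D -> sym_incr_convex D psi ->
  row_in D x -> row_in D y1 -> row_in D y2 -> 0 <= t <= 1 ->
  nonincr_row x -> prefix_le x (t *: y1 + (1 - t) *: y2) ->
  psi x <= t * psi y1 + (1 - t) * psi y2.
Proof.
move=> D_convex psi_sym_incr Dx Dy1 Dy2 t01 x_decr le_xy.
have DN y : row_in D y -> row_in (fun u => D (- u)) (- y).
  by move=> Dy i; rewrite mxE opprK.
have D_convexN : convex_pred (fun u => D (- u)).
  by move=> u v s Du Dv s01; rewrite opprD -!mulrN; exact: D_convex.
have := sym_incr_concave_comb D_convexN (sym_incr_convexN psi_sym_incr)
  (DN _ Dx) (DN _ Dy1) (DN _ Dy2) t01 (nonincr_rowN x_decr).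
rewrite !opprK !mulrN -opprD lerN2; apply.
by rewrite !scalerN -opprD; exact: prefix_leN.
Qed.

Lemma sum_col_perm f s x : \sum_i f (col_perm s x 0 i) = \sum_i f (x 0 i).
Proof.
rewrite [RHS](reindex_inj (@perm_inj _ s)).
by apply: eq_bigr => i _; rewrite mxE.
Qed.

Lemma sum_sym_incr_concave D f :
  (forall u v, D u -> D v -> u <= v -> f u <= f v) ->
  (forall u v t, D u -> D v -> 0 <= t <= 1 ->
     t * f u + (1 - t) * f v <= f (t * u + (1 - t) * v)) ->
  sym_incr_concave D (fun x => \sum_i f (x 0 i)).
Proof.
move=> f_incr f_concave; split=> [s x _|x y Dx Dy le_xy|x y t Dx Dy t01].
- exact: sum_col_perm.
- by apply: ler_sum => i _; exact: f_incr.
- rewrite !mulr_sumr -big_split; apply: ler_sum => i _.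
  by rewrite !mxE; exact: f_concave.
Qed.

Lemma sum_sym_incr_convex D f :
  (forall u v, D u -> D v -> u <= v -> f u <= f v) ->
  (forall u v t, D u -> D v -> 0 <= t <= 1 ->
     f (t * u + (1 - t) * v) <= t * f u + (1 - t) * f v) ->
  sym_incr_convex D (fun x => \sum_i f (x 0 i)).
Proof.
move=> f_incr f_convex; split=> [s x _|x y Dx Dy le_xy|x y t Dx Dy t01].
- exact: sum_col_perm.
- by apply: ler_sum => i _; exact: f_incr.
- rewrite !mulr_sumr -big_split; apply: ler_sum => i _.
  by rewrite !mxE; exact: f_convex.
Qed.

End SymmetricConcaveFunctions.

Section PositiveNumbers.
Variable R : realFieldType.

Lemma convex_pred_ge0 : convex_pred (fun u : R => 0 <= u).
Proof.
by move=> u v t u_ge0 v_ge0 /andP[t_ge0 t_le1]; rewrite addr_ge0 ?mulr_ge0 ?subr_ge0.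
Qed.

Lemma convex_pred_gt0 : convex_pred (fun u : R => 0 < u).
Proof.
move=> u v t u_gt0 v_gt0 /andP[t_ge0 t_le1].
have [->|t_neq0] := eqVneq t 0; first by rewrite mul0r add0r subr0 mul1r.
by rewrite ltr_pwDl ?mulr_ge0 ?subr_ge0 ?mulr_gt0 ?(ltW v_gt0) // lt_def t_neq0.
Qed.

Lemma invr_convex_gt0 (u v t : R) : 0 < u -> 0 < v -> 0 <= t <= 1 ->
  (t * u + (1 - t) * v)^-1 <= t * u^-1 + (1 - t) * v^-1.
Proof.
move=> u_gt0 v_gt0 t01; have w_gt0 := convex_pred_gt0 u_gt0 v_gt0 t01.
have /andP[t_ge0 t_le1] := t01.
have -> : t * u^-1 + (1 - t) * v^-1 = (t * v + (1 - t) * u) / (u * v).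
  by field; rewrite !gt_eqF.
rewrite ler_pdivlMr ?mulr_gt0 // mulrC ler_pdivrMr //.
have -> : (t * v + (1 - t) * u) * (t * u + (1 - t) * v) =
  u * v + t * (1 - t) * (u - v) ^+ 2 by ring.
by rewrite lerDl mulr_ge0 ?sqr_ge0 // mulr_ge0 // subr_ge0.
Qed.

End PositiveNumbers.

Section ComplexModulus.
Variable R : realType.
Local Notation C := R[i].
Implicit Types (a b : C) (x y : R).

HB.instance Definition _ := GRing.RMorphism.copy (@cR R) (real_complex R).

Lemma cR_ge0 x : (0 <= cR x) = (0 <= x). Proof. exact: ler0c. Qed.

Lemma cR_gt0 x : (0 < cR x) = (0 < x). Proof. exact: ltcR. Qed.

Lemma ler_cR x y : (cR x <= cR y) = (x <= y). Proof. exact: lecR. Qed.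

Lemma conj_cR x : (cR x)^* = cR x.
Proof. by apply/CrealP; rewrite complex_real. Qed.

Lemma Re_cRM x a : complex.Re (cR x * a) = x * complex.Re a.
Proof. by case: a => a1 a2 /=; rewrite mul0r subr0. Qed.

Lemma Re_ge0 a : 0 <= a -> 0 <= complex.Re a.
Proof. by rewrite lecE => /andP[]. Qed.

Lemma normE a : `|a| = cR (cabs a).
Proof. by rewrite /cabs normc_def. Qed.

Lemma cabs_ge0 a : 0 <= cabs a.
Proof. by rewrite -cR_ge0 -normE. Qed.

Lemma cabs_eq0 a : cabs a = 0 -> a = 0.
Proof. exact: Normc.eq0_normc. Qed.

Lemma cabsN a : cabs (- a) = cabs a.
Proof. by rewrite /cabs normrN. Qed.

Lemma cabsM a b : cabs (a * b) = cabs a * cabs b.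
Proof. exact: Normc.normcM. Qed.

Lemma cabsV a : cabs a^-1 = (cabs a)^-1.
Proof. exact: Normc.normcV. Qed.

Lemma cabs_conj a : cabs a^* = cabs a.
Proof. by rewrite /cabs norm_conjC. Qed.

Lemma cabs_cR x : 0 <= x -> cabs (cR x) = x.
Proof. by move=> x_ge0; rewrite /cabs ger0_norm ?cR_ge0. Qed.

Lemma cabsD a b : cabs (a + b) <= cabs a + cabs b.
Proof. exact: (@ler_normD _ (Rcomplex R)). Qed.

Lemma cabs_sum (I : finType) (P : pred I) (F : I -> C) :
  cabs (\sum_(i | P i) F i) <= \sum_(i | P i) cabs (F i).
Proof.
rewrite -ler_cR rmorph_sum -normE /=; under [leRHS]eq_bigr do rewrite -normE.
exact: ler_norm_sum.
Qed.

Lemma Re_le_cabs a : complex.Re a <= cabs a.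
Proof.
rewrite -ler_cR -normE; apply: le_trans (normc_ge_Re a).
by rewrite -[leRHS]/(cR _) ler_cR ler_norm.
Qed.

Lemma mul_conj_cabs a : a * a^* = cR (cabs a ^+ 2).
Proof. by rewrite -normCK normE rmorphXn. Qed.

Lemma unit_phase a : exists2 c, `|c| = 1 & c * a = cR (cabs a).
Proof.
have [->|a_neq0] := eqVneq a 0.
  by exists 1; rewrite ?normr1 // mulr0 -normE normr0.
exists (a^* / `|a|); first by rewrite normf_div norm_conjC normr_id divff ?normr_eq0.
by rewrite mulrAC [_^* * _]mulrC -normCK expr2 mulfK ?normr_eq0 // normE.
Qed.

End ComplexModulus.

Section Adjoint.
Variable R : realType.
Local Notation C := R[i].

Lemma adjM m n q (A : 'M[C]_(m, n)) (B : 'M[C]_(n, q)) :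
  adj (A *m B) = adj B *m adj A.
Proof. by rewrite /adj trmx_mul map_mxM. Qed.

Lemma adjK m n (A : 'M[C]_(m, n)) : adj (adj A) = A.
Proof. exact: trmxCK. Qed.

Lemma adjD m n (A B : 'M[C]_(m, n)) : adj (A + B) = adj A + adj B.
Proof. by rewrite /adj linearD map_mxD. Qed.

Lemma adjZ m n (c : C) (A : 'M[C]_(m, n)) : adj (c *: A) = c^* *: adj A.
Proof. by rewrite /adj linearZ map_mxZ. Qed.

End Adjoint.

Section UnitaryConjugation.
Variables (R : realType) (p : nat).
Local Notation C := R[i].
Implicit Types (A B U V : 'M[C]_p) (s : 'S_p).

Lemma unitary_mul_adj U : U \is unitarymx -> U *m adj U = 1%:M.
Proof. by move/unitarymxP. Qed.

Lemma unitary_adj_mul U : U \is unitarymx -> adj U *m U = 1%:M.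
Proof. by move=> /unitary_mul_adj; exact: mulmx1C. Qed.

Lemma unitary_adj U : U \is unitarymx -> adj U \is unitarymx.
Proof. by rewrite /adj trmxC_unitary. Qed.

Lemma adj_perm_mx s : adj (perm_mx s : 'M[C]_p) = perm_mx s^-1.
Proof. by rewrite /adj tr_perm_mx map_perm_mx. Qed.

Lemma unitary_perm_mx s : (perm_mx s : 'M[C]_p) \is unitarymx.
Proof.
by apply/unitarymxP; rewrite -/(adj _) adj_perm_mx -perm_mxM mulgV perm_mx1.
Qed.

Lemma unitary1 : (1%:M : 'M[C]_p) \is unitarymx.
Proof. by rewrite -perm_mx1 unitary_perm_mx. Qed.

Definition adjconj U A := U *m A *m adj U.

Lemma adjconjM U V A : adjconj (U *m V) A = adjconj U (adjconj V A).
Proof. by rewrite /adjconj adjM !mulmxA. Qed.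

Lemma adjconjK U A : U \is unitarymx -> adjconj (adj U) (adjconj U A) = A.
Proof.
move=> U_unit; rewrite -adjconjM unitary_adj_mul // /adjconj mul1mx.
by rewrite -perm_mx1 adj_perm_mx invg1 perm_mx1 mulmx1.
Qed.

Lemma adjconjD U A B : adjconj U (A + B) = adjconj U A + adjconj U B.
Proof. by rewrite /adjconj mulmxDr mulmxDl. Qed.

Lemma adjconjZ U (c : C) A : adjconj U (c *: A) = c *: adjconj U A.
Proof. by rewrite /adjconj -scalemxAr -scalemxAl. Qed.

Lemma adj_adjconj U A : adj (adjconj U A) = adjconj U (adj A).
Proof. by rewrite /adjconj !adjM adjK mulmxA. Qed.

Lemma unitary_row_sum U i : U \is unitarymx -> \sum_j cabs (U i j) ^+ 2 = 1.
Proof.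
move=> /unitary_mul_adj/matrixP/(_ i i); rewrite !mxE eqxx => sum1.
apply: (@complexI R); rewrite rmorph_sum -[RHS]sum1; apply: eq_bigr => j _.
by rewrite !mxE mul_conj_cabs.
Qed.

Lemma unitary_col_sum U j : U \is unitarymx -> \sum_i cabs (U i j) ^+ 2 = 1.
Proof.
move=> /unitary_adj U_unit; rewrite -(unitary_row_sum j U_unit).
by apply: eq_bigr => i _; rewrite !mxE cabs_conj.
Qed.

Lemma unitary_entry_le1 U i j : U \is unitarymx -> cabs (U i j) <= 1.
Proof.
move=> U_unit; rewrite -(@expr_le1 _ 2) ?cabs_ge0 // -(unitary_row_sum i U_unit).
by rewrite (bigD1 j) //= lerDl sumr_ge0 // => k _; exact: sqr_ge0.
Qed.

End UnitaryConjugation.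

Section HermitianForms.
Variables (R : realType) (p : nat).
Local Notation C := R[i].
Implicit Types (A U V : 'M[C]_p) (v w : 'cV[C]_p) (c : C) (t : R).

Definition hform A v w : C := (adj v *m A *m w) 0 0.

Lemma hform_conj A v w : adj A = A -> hform A w v = (hform A v w)^*.
Proof.
move=> A_herm; rewrite /hform.
have -> : adj w *m A *m v = adj (adj v *m A *m w) by rewrite !adjM adjK A_herm mulmxA.
by rewrite mxE mxE.
Qed.

Lemma hformBZ A v w c : hform A (v - c *: w) (v - c *: w) =
  hform A v v - c * hform A v w - c^* * hform A w v + c * c^* * hform A w w.
Proof.
rewrite /hform -scaleNr adjD adjZ rmorphN.
rewrite mulmxDl mulmxDl !mulmxDr -!scalemxAl -!scalemxAr scalerA.
move: (adj v *m A *m v) (adj v *m A *m w) => vAv vAw.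
move: (adj w *m A *m v) (adj w *m A *m w) => wAv wAw.
by rewrite !mxE; ring.
Qed.

Lemma hform_adjconj U A v w :
  hform (adjconj U A) v w = hform A (adj U *m v) (adj U *m w).
Proof. by rewrite /hform /adjconj adjM adjK !mulmxA. Qed.

Lemma entry_hform U A V i j :
  (U *m A *m V) i j = hform A (col i (adj U)) (col j V).
Proof.
have adj_col : adj (col i (adj U)) = row i U.
  by apply/matrixP => a b; rewrite !mxE conjCK.
rewrite /hform adj_col -row_mul !mxE.
by apply: eq_bigr => k _; rewrite !mxE.
Qed.

(* Positivity of [A] at [v - c *: w], with the phase [c] making [v^* A w] real. *)
Lemma cabs_hform_le_mean A v w : psdmx A ->
  2 * cabs (hform A v w) <= complex.Re (hform A v v) + complex.Re (hform A w w).
Proof.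
move=> [A_herm A_ge0]; have [c c1 cE] := unit_phase (hform A v w).
have cE_conj : c^* * hform A w v = cR (cabs (hform A v w)).
  by rewrite (hform_conj _ _ A_herm) -rmorphM /= cE conj_cR.
have := A_ge0 (v - c *: w); rewrite -/(hform _ _ _) hformBZ cE cE_conj.
rewrite -normCK c1 expr1n mul1r => /Re_ge0.
by rewrite !raddfD !raddfN /=; lra.
Qed.

Lemma psdmx_adjconj U A : psdmx A -> psdmx (adjconj U A).
Proof.
move=> [A_herm A_ge0]; split=> [|v]; first by rewrite adj_adjconj A_herm.
by rewrite -/(hform _ _ _) hform_adjconj; exact: A_ge0.
Qed.

Lemma pdmx_adjconj U A : U \is unitarymx -> pdmx A -> pdmx (adjconj U A).
Proof.
move=> U_unit [A_herm A_gt0]; split=> [|v v_neq0]; first by rewrite adj_adjconj A_herm.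
rewrite -/(hform _ _ _) hform_adjconj; apply: A_gt0; apply: contraNneq v_neq0 => Uv0.
by rewrite -[v]mul1mx -(unitary_mul_adj U_unit) -mulmxA Uv0 mulmx0.
Qed.

Lemma pdmx_psdmx A : pdmx A -> psdmx A.
Proof.
move=> [A_herm A_gt0]; split=> // v.
have [->|v_neq0] := eqVneq v 0; first by rewrite mulmx0 mxE.
by rewrite ltW // A_gt0.
Qed.

Lemma psdmxZ t A : 0 <= t -> psdmx A -> psdmx (cR t *: A).
Proof.
move=> t_ge0 [A_herm A_ge0]; split=> [|v]; first by rewrite adjZ conj_cR A_herm.
by rewrite -scalemxAr -scalemxAl mxE mulr_ge0 // cR_ge0.
Qed.

Lemma pdmx_comb t A B :
  pdmx A -> pdmx B -> 0 <= t <= 1 -> pdmx (cR t *: A + cR (1 - t) *: B).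
Proof.
move=> A_pd B_pd /andP[t_ge0 t_le1]; have t'_ge0 : 0 <= 1 - t by rewrite subr_ge0.
have tA_psd := psdmxZ t_ge0 (pdmx_psdmx A_pd).
have tB_psd := psdmxZ t'_ge0 (pdmx_psdmx B_pd).
split=> [|v v_neq0]; first by rewrite adjD tA_psd.1 tB_psd.1.
rewrite mulmxDr mulmxDl mxE.
have [t0|t_neq0] := eqVneq t 0.
  by rewrite t0 subr0 rmorph0 rmorph1 scale0r scale1r mulmx0 mul0mx mxE add0r B_pd.2.
apply: ltr_pwDl; last exact: tB_psd.2.
by rewrite -scalemxAr -scalemxAl mxE mulr_gt0 ?A_pd.2 // cR_gt0 lt_def t_neq0.
Qed.

End HermitianForms.

Section RealDiagonal.
Variables (R : realType) (p : nat).
Local Notation C := R[i].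
Implicit Types (d e r : 'rV[R]_p) (t : R) (s : 'S_p).

Definition diagR d : 'M[C]_p := diag_mx (map_mx (@cR R) d).

Lemma diagRE d i j : diagR d i j = cR (d 0 i) *+ (i == j).
Proof. by rewrite !mxE; case: eqP => [->|]. Qed.

Lemma diagRD d e : diagR (d + e) = diagR d + diagR e.
Proof. by rewrite /diagR map_mxD linearD. Qed.

Lemma diagRN d : diagR (- d) = - diagR d.
Proof. by rewrite /diagR map_mxN linearN. Qed.

Lemma diagRZ t d : diagR (t *: d) = cR t *: diagR d.
Proof. by rewrite /diagR map_mxZ linearZ. Qed.

Lemma diagRM d e : diagR d *m diagR e = diagR (\row_i (d 0 i * e 0 i)).
Proof.
rewrite /diagR mulmx_diag; congr diag_mx.
by apply/rowP => i; rewrite !mxE rmorphM.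
Qed.

Lemma adj_diagR d : adj (diagR d) = diagR d.
Proof.
rewrite /adj tr_diag_mx map_diag_mx; congr diag_mx.
by apply/rowP => i; rewrite !mxE; exact: conj_cR.
Qed.

Lemma adjconj_perm_diagR d s : adjconj (perm_mx s) (diagR d) = diagR (col_perm s d).
Proof.
rewrite /adjconj adj_perm_mx -row_permE -col_permE.
by apply/matrixP => i j; rewrite mxE mxE !diagRE (inj_eq perm_inj) mxE.
Qed.

Lemma hform_diagR d (v : 'cV[C]_p) :
  hform (diagR d) v v = cR (\sum_i d 0 i * cabs (v i 0) ^+ 2).
Proof.
rewrite /hform mul_mx_diag mxE rmorph_sum; apply: eq_bigr => i _.
by rewrite !mxE rmorphM /= -mul_conj_cabs; ring.
Qed.

Lemma hform_diagR_delta d i :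
  hform (diagR d) (delta_mx i 0) (delta_mx i 0) = cR (d 0 i).
Proof.
rewrite hform_diagR (bigD1 i) //= mxE !eqxx big1 => [|j /negPf ne_ji].
  by rewrite /cabs normr1 expr1n mulr1 addr0.
by rewrite mxE ne_ji /cabs normr0 expr0n mulr0.
Qed.

Lemma psdmx_diagR d : psdmx (diagR d) <-> forall i, 0 <= d 0 i.
Proof.
split=> [[_ d_ge0] i|d_ge0]; first by rewrite -cR_ge0 -hform_diagR_delta; exact: d_ge0.
split=> [|v]; first exact: adj_diagR.
rewrite -/(hform _ _ _) hform_diagR cR_ge0; apply: sumr_ge0 => i _.
by rewrite mulr_ge0 ?sqr_ge0.
Qed.

Lemma pdmx_diagR d : pdmx (diagR d) <-> forall i, 0 < d 0 i.
Proof.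
split=> [[_ d_gt0] i|d_gt0].
  rewrite -cR_gt0 -hform_diagR_delta; apply: d_gt0.
  by apply/matrix0Pn; exists i, 0; rewrite mxE !eqxx oner_eq0.
split=> [|v /matrix0Pn[i [j v_neq0]]]; first exact: adj_diagR.
rewrite ord1 in v_neq0; rewrite -/(hform _ _ _) hform_diagR cR_gt0 (bigD1 i) //=.
apply: ltr_pwDl; last by apply: sumr_ge0 => k _; rewrite mulr_ge0 ?sqr_ge0 // ltW.
rewrite mulr_gt0 // exprn_gt0 // lt_def cabs_ge0 andbT.
by apply: contra_neq v_neq0 => /cabs_eq0.
Qed.

Lemma unitary_diag_mx (c : 'rV[C]_p) :
  (forall i, `|c 0 i| = 1) -> diag_mx c \is unitarymx.
Proof.
move=> c1; apply/unitarymxP/matrixP => i j; rewrite mul_diag_mx !mxE eq_sym.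
by case: eqP => [->|_]; rewrite ?rmorph0 ?mulr0 // -normCK c1 expr1n.
Qed.

(* Each entry in [-1, 1] is the real part of a complex number of modulus one. *)
Lemma diagR_half_sum_unitary r : (forall i, `|r 0 i| <= 1) ->
  exists2 D, D \is unitarymx & diagR r = cR 2^-1 *: (D + adj D).
Proof.
move=> r_le1; pose c : 'rV[C]_p := \row_i Complex (r 0 i) (Num.sqrt (1 - r 0 i ^+ 2)).
exists (diag_mx c).
  apply: unitary_diag_mx => i; rewrite mxE normc_def /= sqr_sqrtr.
    by rewrite addrC subrK sqrtr1.
  by rewrite subr_ge0 -real_normK ?num_real // expr_le1.
apply/matrixP => i j; rewrite diagRE !mxE [j == i]eq_sym.
have [->|_] := eqVneq i j; last by rewrite rmorph0 addr0 mulr0.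
by apply/eqP; rewrite !mulr1n eq_complex /=; apply/andP; split; apply/eqP; field.
Qed.

End RealDiagonal.

Section Diagonalization.
Variables (R : realType) (p : nat).
Local Notation C := R[i].
Implicit Types (A U V : 'M[C]_p) (d e : 'rV[R]_p) (s : 'S_p).

Definition diagonalizes U d A := U \is unitarymx /\ A = adjconj U (diagR d).

Lemma diagonalizes_herm U d A : diagonalizes U d A -> adj A = A.
Proof. by case=> _ ->; rewrite adj_adjconj adj_diagR. Qed.

Lemma diagonalizes_psdmx U d A :
  diagonalizes U d A -> psdmx A <-> forall i, 0 <= d 0 i.
Proof.
case=> U_unit ->; rewrite -psdmx_diagR; split; last exact: psdmx_adjconj.
by rewrite -{2}[diagR d](adjconjK _ U_unit); exact: psdmx_adjconj.
Qed.

Lemma diagonalizes_pdmx U d A :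
  diagonalizes U d A -> pdmx A <-> forall i, 0 < d 0 i.
Proof.
case=> U_unit ->; rewrite -pdmx_diagR; split; last exact: pdmx_adjconj.
by rewrite -{2}[diagR d](adjconjK _ U_unit); apply/pdmx_adjconj/unitary_adj.
Qed.

Lemma diagonalizesN U d A : diagonalizes U d A -> diagonalizes U (- d) (- A).
Proof. by case=> U_unit ->; rewrite /diagonalizes diagRN /adjconj mulmxN mulNmx. Qed.

Lemma diagonalizes_perm U d A s :
  diagonalizes U d A -> diagonalizes (U *m adj (perm_mx s)) (col_perm s d) A.
Proof.
case=> U_unit ->; have s_unit := unitary_perm_mx R s; split.
  exact: mul_unitarymx U_unit (unitary_adj s_unit).
by rewrite adjconjM -adjconj_perm_diagR adjconjK.
Qed.

Lemma diagonalizes_invmx U d A : diagonalizes U d A -> (forall i, d 0 i != 0) ->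
  diagonalizes U (map_mx GRing.inv d) (invmx A).
Proof.
case=> U_unit AE d_neq0; split; first exact: U_unit.
set B := adjconj U _; have AB1 : A *m B = 1%:M.
  rewrite AE /B /adjconj !mulmxA -(mulmxA _ (adj U)) unitary_adj_mul // mulmx1.
  rewrite -(mulmxA U) diagRM (_ : diagR _ = 1%:M) ?mulmx1 ?unitary_mul_adj //.
  by apply/matrixP => i j; rewrite diagRE !mxE mulfV ?rmorph1.
have [A_unit _] := mulmx1_unit AB1.
by rewrite -[LHS]mulmx1 -AB1 mulKmx.
Qed.

Lemma hermitian_diagonalizes A : adj A = A ->
  diagonalizes (adj (spectralmx A)) (map_mx (@complex.Re R) (spectral_diag A)) A.
Proof.
move=> A_herm; have A_hermsym : A \is hermsymmx.
  by apply/is_hermitianmxP; rewrite expr0 scale1r -/(adj A) A_herm.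
have P_unit := spectral_unitarymx A; split; first exact: unitary_adj.
have /orthomx_spectralP {1}-> := hermitian_normalmx A_hermsym.
rewrite invmx_unitary // /adjconj adjK; congr (_ *m diag_mx _ *m _).
apply/rowP => i; rewrite !mxE.
have /mxOverP/(_ 0 i) := hermitian_spectral_diag_real A_hermsym.
by move=> /RRe_real.
Qed.

Definition rediag A : 'rV[R]_p := \row_i complex.Re (A i i).

Lemma rediag_diagR d : rediag (diagR d) = d.
Proof. by apply/rowP => i; rewrite mxE diagRE eqxx. Qed.

Lemma rediagN A : rediag (- A) = - rediag A.
Proof. by apply/rowP => i; rewrite !mxE raddfN. Qed.

Lemma rediag_adjconj_diagR V d i :
  rediag (adjconj V (diagR d)) 0 i = \sum_j cabs (V i j) ^+ 2 * d 0 j.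
Proof.
rewrite mxE entry_hform hform_diagR /=; apply: eq_bigr => j _.
by rewrite !mxE cabs_conj mulrC.
Qed.

Lemma prefix_le_rediag U d A V : diagonalizes U d A -> nondecr_row d ->
  V \is unitarymx -> prefix_le d (rediag (adjconj V A)).
Proof.
move=> [U_unit ->] d_incr V_unit q; rewrite -adjconjM; set W := V *m U.
have W_unit : W \is unitarymx := mul_unitarymx V_unit U_unit.
rewrite [leRHS]/prefix_sum; under eq_bigr do rewrite rediag_adjconj_diagR.
rewrite exchange_big /=; under [leRHS]eq_bigr do rewrite -mulr_suml.
apply: prefix_sum_le_weighted => // [j|].
  rewrite sumr_ge0 /= => [|i _]; last exact: sqr_ge0.
  rewrite -(unitary_col_sum j W_unit) [leLHS]big_mkcond.
  by apply: ler_sum => i _; case: ifP; rewrite // sqr_ge0.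
rewrite exchange_big; apply: eq_bigr => i _.
by rewrite unitary_row_sum // mxE.
Qed.

Lemma rediag_prefix_le U d A V : diagonalizes U d A -> nonincr_row d ->
  V \is unitarymx -> prefix_le (rediag (adjconj V A)) d.
Proof.
move=> /diagonalizesN dA /nonincr_rowN d_incr V_unit.
rewrite -[d]opprK -[rediag _]opprK; apply: prefix_leN.
rewrite -rediagN (_ : - adjconj V A = adjconj V (- A)).
  exact: prefix_le_rediag dA d_incr V_unit.
by rewrite /adjconj mulmxN mulNmx.
Qed.

Lemma diagonalizes_rediag U d A : diagonalizes U d A -> rediag (adjconj (adj U) A) = d.
Proof. by case=> U_unit ->; rewrite adjconjK // rediag_diagR. Qed.

Lemma diagonalizes_nonincr_unique U V d e A :
  diagonalizes U d A -> diagonalizes V e A ->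
  nonincr_row d -> nonincr_row e -> d = e.
Proof.
move=> dA eA d_decr e_decr; apply: prefix_le_anti.
  rewrite -(diagonalizes_rediag dA).
  exact: rediag_prefix_le eA e_decr (unitary_adj dA.1).
rewrite -(diagonalizes_rediag eA).
exact: rediag_prefix_le dA d_decr (unitary_adj eA.1).
Qed.

End Diagonalization.

Section Eigenvalues.
Variables (R : realType) (p : nat).
Local Notation C := R[i].
Implicit Types (A U V : 'M[C]_p) (d : 'rV[R]_p) (i j : 'I_p) (f : R -> R).

Definition eig_decr A : 'rV[R]_p := \row_i eigval A i.+1.
Definition eig_incr A : 'rV[R]_p := \row_i eigval A (p - i).

Lemma eig_incr_perm A : eig_incr A = col_perm (perm rev_ord_inj) (eig_decr A).
Proof. by apply/rowP => i; rewrite !mxE permE /= subnSK. Qed.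

Lemma eig_decr_perm A : exists s : 'S_p,
  eig_decr A = col_perm s (map_mx (@complex.Re R) (spectral_diag A)).
Proof.
have /tuple_permP[s Es] : perm_eq (eigs A)
    [tuple complex.Re (spectral_diag A 0 i) | i < p].
  by rewrite /= perm_sort.
exists s; apply/rowP => i.
by rewrite !mxE /eigval Es /= nth_mktuple tnth_mktuple.
Qed.

Lemma eig_decr_nonincr A : nonincr_row (eig_decr A).
Proof.
move=> i j le_ij; rewrite !mxE /eigval /=.
have sz_eigs : size (eigs A) = p by rewrite size_sort size_map size_enum_ord.
have le_trans_rev : transitive (fun x y : R => y <= x).
  by move=> y x z le_yx le_zy; exact: le_trans le_zy le_yx.
have le_total_rev : total (fun x y : R => y <= x) by move=> x y; exact: le_total.
apply: (sorted_leq_nth le_trans_rev (@lexx _ R) 0 (sort_sorted le_total_rev _)) => //.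
  by rewrite inE sz_eigs.
by rewrite inE sz_eigs.
Qed.

Lemma eig_incr_nondecr A : nondecr_row (eig_incr A).
Proof.
move=> i j le_ij; rewrite eig_incr_perm mxE [leRHS]mxE !permE.
by apply: eig_decr_nonincr; rewrite /= leq_sub2l.
Qed.

Lemma diagonalizes_eig_decr A : adj A = A -> exists U, diagonalizes U (eig_decr A) A.
Proof.
move=> /hermitian_diagonalizes dA; have [s ->] := eig_decr_perm A.
by eexists; exact: diagonalizes_perm dA.
Qed.

Lemma diagonalizes_eig_incr A : adj A = A -> exists U, diagonalizes U (eig_incr A) A.
Proof.
move=> /diagonalizes_eig_decr[U dA]; rewrite eig_incr_perm.
by eexists; exact: diagonalizes_perm dA.
Qed.

Lemma eig_decrE U d A : diagonalizes U d A -> nonincr_row d -> eig_decr A = d.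
Proof.
move=> dA d_decr; have [V eA] := diagonalizes_eig_decr (diagonalizes_herm dA).
exact: diagonalizes_nonincr_unique eA dA (@eig_decr_nonincr A) d_decr.
Qed.

Lemma eig_decr_ge0 A : psdmx A -> row_in (fun u => 0 <= u) (eig_decr A).
Proof.
move=> A_psd; have [U dA] := diagonalizes_eig_decr A_psd.1.
exact/(diagonalizes_psdmx dA).
Qed.

Lemma eig_incr_ge0 A : psdmx A -> row_in (fun u => 0 <= u) (eig_incr A).
Proof. by move=> /eig_decr_ge0 A_ge0 i; rewrite eig_incr_perm mxE. Qed.

Lemma eig_decr_gt0 A : pdmx A -> row_in (fun u => 0 < u) (eig_decr A).
Proof.
move=> A_pd; have [U dA] := diagonalizes_eig_decr A_pd.1.
exact/(diagonalizes_pdmx dA).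
Qed.

Lemma eig_incr_gt0 A : pdmx A -> row_in (fun u => 0 < u) (eig_incr A).
Proof. by move=> /eig_decr_gt0 A_gt0 i; rewrite eig_incr_perm mxE. Qed.

Lemma diagonalizes_invmx_eig_incr A : pdmx A ->
  exists U, diagonalizes U (map_mx GRing.inv (eig_incr A)) (invmx A).
Proof.
move=> A_pd; have [U dA] := diagonalizes_eig_incr A_pd.1; exists U.
by apply: diagonalizes_invmx dA _ => i; rewrite lt0r_neq0 // eig_incr_gt0.
Qed.

Lemma pdmx_invmx A : pdmx A -> pdmx (invmx A).
Proof.
move=> A_pd; have [U dA] := diagonalizes_invmx_eig_incr A_pd.
by apply/(diagonalizes_pdmx dA) => i; rewrite mxE invr_gt0 eig_incr_gt0.
Qed.

Lemma eig_decr_invmx A : pdmx A -> eig_decr (invmx A) = map_mx GRing.inv (eig_incr A).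
Proof.
move=> A_pd; have [U dA] := diagonalizes_invmx_eig_incr A_pd.
apply: eig_decrE dA _ => i j le_ij; rewrite mxE [leRHS]mxE.
by rewrite lef_pV2 ?posrE ?eig_incr_gt0 //; exact: eig_incr_nondecr.
Qed.

Lemma kyfan_normE k A : (k <= p)%N -> kyfan_norm k A = prefix_sum k (eig_decr A).
Proof.
move=> le_kp; rewrite /kyfan_norm big_add1 /= big_mkord.
rewrite (big_ord_widen p (fun i : nat => eigval A i.+1)) //.
by apply: eq_bigr => i _; rewrite mxE.
Qed.

Lemma kyfan_antinormE k A :
  (k <= p)%N -> kyfan_antinorm k A = prefix_sum k (eig_incr A).
Proof.
move=> le_kp; rewrite /kyfan_antinorm big_add1 /= big_mkord.
rewrite (big_ord_widen p (fun i : nat => eigval A (p + 1 - i.+1))) //.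
by apply: eq_bigr => i _; rewrite mxE addn1 subSS.
Qed.

Lemma trf_eig_decr f A : trf f A = \sum_i f (eig_decr A 0 i).
Proof.
have [s ->] := eig_decr_perm A; rewrite sum_col_perm.
rewrite /trf /mxfun -mulmxA mxtrace_mulC mulmxK ?spectral_unit //.
rewrite mxtrace_diag raddf_sum.
by apply: eq_bigr => i _; rewrite !mxE.
Qed.

Lemma trf_eig_incr f A : trf f A = \sum_i f (eig_incr A 0 i).
Proof. by rewrite eig_incr_perm sum_col_perm trf_eig_decr. Qed.

Lemma trf_invmx f A : pdmx A -> trf f (invmx A) = trf (fun u => f u^-1) A.
Proof.
move=> A_pd; rewrite trf_eig_decr eig_decr_invmx // trf_eig_incr.
by apply: eq_bigr => i _; rewrite mxE.
Qed.

Lemma trfN f A : trf (fun u => - f u) A = - trf f A.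
Proof. by rewrite !trf_eig_decr sumrN. Qed.

End Eigenvalues.

Section EntryNorm.
Variables (R : realType) (p : nat).
Local Notation C := R[i].
Implicit Types (A B X U V : 'M[C]_p).

Definition entry_norm X : R := \sum_i \sum_j cabs (X i j).

Lemma entry_normN X : entry_norm (- X) = entry_norm X.
Proof. by apply: eq_bigr => i _; apply: eq_bigr => j _; rewrite mxE cabsN. Qed.

Lemma unitary_entry_le_entry_norm U V X i j :
  U \is unitarymx -> V \is unitarymx -> cabs ((U *m X *m V) i j) <= entry_norm X.
Proof.
move=> U_unit V_unit; rewrite mxE /entry_norm exchange_big /=.
apply: (le_trans (cabs_sum _ _)); apply: ler_sum => b _.
rewrite cabsM -[leRHS]mulr1; apply: ler_pM; rewrite ?cabs_ge0 ?unitary_entry_le1 //.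
rewrite mxE; apply: (le_trans (cabs_sum _ _)); apply: ler_sum => a _.
by rewrite cabsM -[leRHS]mul1r ler_wpM2r ?cabs_ge0 ?unitary_entry_le1.
Qed.

Lemma lipschitz_continuous_on_psd (N : 'M[C]_p -> R) (c : R) : 0 <= c ->
  (forall A B, psdmx A -> psdmx B -> `|N B - N A| <= c * entry_norm (B - A)) ->
  continuous_on_psd N.
Proof.
move=> c_ge0 N_lip A A_psd e e_gt0; pose M := c * (p * p)%:R.
have M_ge0 : 0 <= M by rewrite mulr_ge0.
have M1_gt0 : 0 < M + 1 by rewrite ltr_wpDl.
exists (e / (M + 1)) => [|B B_psd BA_lt]; first by rewrite divr_gt0.
apply: (le_lt_trans (N_lip _ _ A_psd B_psd)).
have entry_le : entry_norm (B - A) <= (p * p)%:R * (e / (M + 1)).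
  rewrite mulr_natl mulrnA -[X in _ *+ X]card_ord -sumr_const; apply: ler_sum => i _.
  rewrite -[X in _ *+ X]card_ord -sumr_const; apply: ler_sum => j _.
  by rewrite !mxE ltW.
apply: (le_lt_trans (ler_wpM2l c_ge0 entry_le)); rewrite !mulrA -/M.
by rewrite ltr_pdivrMr // mulrDr mulr1 mulrC ltrDl.
Qed.

End EntryNorm.

Section DiagonalSums.
Variables (R : realType) (p k : nat).
Local Notation C := R[i].
Implicit Types (X Y U V : 'M[C]_p) (t : R).

Definition diag_sum X : R := \sum_(i < p | (i < k)%N) complex.Re (X i i).

Lemma diag_sum_rediag X : diag_sum X = prefix_sum k (rediag X).
Proof. by apply: eq_bigr => i _; rewrite mxE. Qed.

Lemma diag_sumD X Y : diag_sum (X + Y) = diag_sum X + diag_sum Y.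
Proof. by rewrite -big_split; apply: eq_bigr => i _; rewrite mxE raddfD. Qed.

Lemma diag_sumZ t X : diag_sum (cR t *: X) = t * diag_sum X.
Proof. by rewrite mulr_sumr; apply: eq_bigr => i _; rewrite mxE Re_cRM. Qed.

Definition abs_diag_sum X : R := \sum_(i < p | (i < k)%N) cabs (X i i).

Lemma abs_diag_sum_ge0 X : 0 <= abs_diag_sum X.
Proof. by apply: sumr_ge0 => i _; exact: cabs_ge0. Qed.

Lemma abs_diag_sumZ (c : C) X : abs_diag_sum (c *: X) = cabs c * abs_diag_sum X.
Proof. by rewrite mulr_sumr; apply: eq_bigr => i _; rewrite mxE cabsM. Qed.

Lemma abs_diag_sumD X Y : abs_diag_sum (X + Y) <= abs_diag_sum X + abs_diag_sum Y.
Proof. by rewrite -big_split; apply: ler_sum => i _; rewrite mxE cabsD. Qed.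

Lemma diag_sum_le_abs X : diag_sum X <= abs_diag_sum X.
Proof. by apply: ler_sum => i _; exact: Re_le_cabs. Qed.

Lemma abs_diag_sum_unitary_le U V X : U \is unitarymx -> V \is unitarymx ->
  abs_diag_sum (U *m X *m V) <= p%:R * entry_norm X.
Proof.
move=> U_unit V_unit; rewrite mulr_natl -[X in _ *+ X]card_ord -sumr_const.
rewrite /abs_diag_sum big_mkcond; apply: ler_sum => i _.
have := unitary_entry_le_entry_norm X i i U_unit V_unit.
by case: ifP => // _; apply: le_trans; exact: cabs_ge0.
Qed.

End DiagonalSums.

Section KyFanAntinorm.
Variables (R : realType) (p k : nat).
Hypothesis le_kp : (k <= p)%N.
Local Notation C := R[i].
Implicit Types (A B U : 'M[C]_p) (t : R).

Lemma kyfan_antinorm_le A U : adj A = A -> U \is unitarymx ->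
  kyfan_antinorm k A <= diag_sum k (adjconj U A).
Proof.
move=> /diagonalizes_eig_incr[V dA] U_unit; rewrite kyfan_antinormE // diag_sum_rediag.
exact: prefix_le_rediag dA (@eig_incr_nondecr _ _ A) U_unit k.
Qed.

Lemma kyfan_antinorm_attained A : adj A = A ->
  exists2 U, U \is unitarymx & kyfan_antinorm k A = diag_sum k (adjconj U A).
Proof.
move=> /diagonalizes_eig_incr[U dA]; exists (adj U); first exact: unitary_adj dA.1.
by rewrite diag_sum_rediag (diagonalizes_rediag dA) kyfan_antinormE.
Qed.

Lemma kyfan_antinorm_ge0 A : psdmx A -> 0 <= kyfan_antinorm k A.
Proof.
move=> /eig_incr_ge0 A_ge0; rewrite kyfan_antinormE //.
by apply: sumr_ge0 => i _; exact: A_ge0.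
Qed.

Lemma kyfan_antinormD A B : adj A = A -> adj B = B ->
  kyfan_antinorm k A + kyfan_antinorm k B <= kyfan_antinorm k (A + B).
Proof.
move=> A_herm B_herm; have AB_herm : adj (A + B) = A + B by rewrite adjD A_herm B_herm.
have [U U_unit ->] := kyfan_antinorm_attained AB_herm.
by rewrite adjconjD diag_sumD lerD // kyfan_antinorm_le.
Qed.

Lemma kyfan_antinormZ t A : 0 <= t -> adj A = A ->
  kyfan_antinorm k (cR t *: A) = t * kyfan_antinorm k A.
Proof.
move=> t_ge0 A_herm; have tA_herm : adj (cR t *: A) = cR t *: A.
  by rewrite adjZ conj_cR A_herm.
apply/le_anti/andP; split.
  have [U U_unit ->] := kyfan_antinorm_attained A_herm.
  by rewrite -diag_sumZ -adjconjZ kyfan_antinorm_le.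
have [U U_unit ->] := kyfan_antinorm_attained tA_herm.
by rewrite adjconjZ diag_sumZ ler_wpM2l // kyfan_antinorm_le.
Qed.

Lemma kyfan_antinorm_adjconj_le U A : U \is unitarymx -> adj A = A ->
  kyfan_antinorm k (adjconj U A) <= kyfan_antinorm k A.
Proof.
move=> U_unit A_herm; have [V V_unit ->] := kyfan_antinorm_attained A_herm.
rewrite -{2}(adjconjK A U_unit) -adjconjM; apply: kyfan_antinorm_le.
  by rewrite adj_adjconj A_herm.
exact: mul_unitarymx V_unit (unitary_adj U_unit).
Qed.

Lemma kyfan_antinorm_adjconj U A : U \is unitarymx -> adj A = A ->
  kyfan_antinorm k (adjconj U A) = kyfan_antinorm k A.
Proof.
move=> U_unit A_herm; apply/le_anti/andP; split; first exact: kyfan_antinorm_adjconj_le.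
rewrite -{1}(adjconjK A U_unit).
apply: kyfan_antinorm_adjconj_le (unitary_adj U_unit) _.
by rewrite adj_adjconj A_herm.
Qed.

Lemma kyfan_antinormB_le A B : adj A = A -> adj B = B ->
  kyfan_antinorm k B - kyfan_antinorm k A <= p%:R * entry_norm (B - A).
Proof.
move=> A_herm B_herm; have [U U_unit ->] := kyfan_antinorm_attained A_herm.
rewrite lerBlDr; apply: (le_trans (kyfan_antinorm_le B_herm U_unit)).
rewrite -{1}[B](subrK A) adjconjD diag_sumD lerD2r.
apply: (le_trans (diag_sum_le_abs _ _)).
exact: abs_diag_sum_unitary_le U_unit (unitary_adj U_unit).
Qed.

Lemma kyfan_antinorm_lipschitz A B : adj A = A -> adj B = B ->
  `|kyfan_antinorm k B - kyfan_antinorm k A| <= p%:R * entry_norm (B - A).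
Proof.
move=> A_herm B_herm; rewrite ler_norml kyfan_antinormB_le // andbT lerNl opprB.
by rewrite -(opprB A B) entry_normN kyfan_antinormB_le.
Qed.

Lemma kyfan_antinorm_symmetric : symmetric_antinorm (@kyfan_antinorm R p k).
Proof.
split=> [A||t A t_ge0 [A_herm _]|U A U_unit [A_herm _]|A B [A_herm _] [B_herm _]].
- exact: kyfan_antinorm_ge0.
- apply: (lipschitz_continuous_on_psd (ler0n R p)) => A B [A_herm _] [B_herm _].
  exact: kyfan_antinorm_lipschitz.
- exact: kyfan_antinormZ.
- exact: kyfan_antinorm_adjconj.
- exact: kyfan_antinormD.
Qed.

End KyFanAntinorm.

Section KyFanNorm.
Variables (R : realType) (p k : nat).
Hypothesis k_bounds : (1 <= k <= p)%N.
Local Notation C := R[i].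
Implicit Types (A X Y U V : 'M[C]_p) (c : C).

Let le_kp : (k <= p)%N. Proof. by case/andP: k_bounds. Qed.

Definition unitary_diag_sums X : set R :=
  [set s | exists U V, [/\ U \is unitarymx, V \is unitarymx &
                           s = abs_diag_sum k (U *m X *m V)]].

(* [kyfan_norm] is meaningful only on Hermitian matrices; this is the sum of the
   [k] largest singular values, written variationally. *)
Definition kyfan_singular X : R := sup (unitary_diag_sums X).

Lemma unitary_diag_sums_has_sup X : has_sup (unitary_diag_sums X).
Proof.
split.
  exists (abs_diag_sum k (1%:M *m X *m 1%:M)), 1%:M, 1%:M.
  by split=> //; exact: unitary1.
exists (p%:R * entry_norm X) => _ [U [V [U_unit V_unit ->]]].
exact: abs_diag_sum_unitary_le.
Qed.

Lemma abs_diag_sum_le_kyfan_singular U V X : U \is unitarymx -> V \is unitarymx ->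
  abs_diag_sum k (U *m X *m V) <= kyfan_singular X.
Proof.
move=> U_unit V_unit; apply: sup_upper_bound; last by exists U, V.
exact: unitary_diag_sums_has_sup.
Qed.

Lemma kyfan_singular_le X (b : R) :
  (forall U V, U \is unitarymx -> V \is unitarymx ->
     abs_diag_sum k (U *m X *m V) <= b) -> kyfan_singular X <= b.
Proof.
move=> le_b; apply: ge_sup; first by case: (unitary_diag_sums_has_sup X).
by move=> _ [U [V [U_unit V_unit ->]]]; exact: le_b.
Qed.

Lemma kyfan_singular_ge0 X : 0 <= kyfan_singular X.
Proof.
apply: (le_trans (abs_diag_sum_ge0 k (1%:M *m X *m 1%:M))).
by apply: abs_diag_sum_le_kyfan_singular; exact: unitary1.
Qed.

Lemma entry_le_kyfan_singular X i j : cabs (X i j) <= kyfan_singular X.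
Proof.
have [lt_0k _] := andP k_bounds; pose i0 : 'I_p := Ordinal (leq_trans lt_0k le_kp).
have := abs_diag_sum_le_kyfan_singular X (unitary_perm_mx R (tperm i0 i))
  (unitary_perm_mx R (tperm i0 j)).
apply: le_trans; rewrite /abs_diag_sum (bigD1 i0) //=.
rewrite -row_permE -(tpermV i0 j) -col_permE !mxE !tpermL lerDl.
by apply: sumr_ge0 => a _; exact: cabs_ge0.
Qed.

Lemma kyfan_singular0_eq0 X : kyfan_singular X = 0 -> X = 0.
Proof.
move=> X0; apply/matrixP => i j; rewrite [RHS]mxE; apply/cabs_eq0/le_anti.
by rewrite cabs_ge0 andbT -X0 entry_le_kyfan_singular.
Qed.

Lemma kyfan_singularZ_le c X : kyfan_singular (c *: X) <= cabs c * kyfan_singular X.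
Proof.
apply: kyfan_singular_le => U V U_unit V_unit.
rewrite -scalemxAr -scalemxAl abs_diag_sumZ ler_wpM2l ?cabs_ge0 //.
exact: abs_diag_sum_le_kyfan_singular.
Qed.

Lemma kyfan_singularZ c X : kyfan_singular (c *: X) = cabs c * kyfan_singular X.
Proof.
apply/le_anti; rewrite kyfan_singularZ_le /=; have [->|c_neq0] := eqVneq c 0.
  by rewrite {1}/cabs normr0 mul0r kyfan_singular_ge0.
have := kyfan_singularZ_le c^-1 (c *: X); rewrite scalerA mulVf // scale1r cabsV.
rewrite ler_pdivlMl // lt_def cabs_ge0 andbT.
by apply: contra_neq c_neq0 => /cabs_eq0.
Qed.

Lemma kyfan_singularD X Y :
  kyfan_singular (X + Y) <= kyfan_singular X + kyfan_singular Y.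
Proof.
apply: kyfan_singular_le => U V U_unit V_unit; rewrite mulmxDr mulmxDl.
apply: (le_trans (abs_diag_sumD _ _ _)).
by apply: lerD; exact: abs_diag_sum_le_kyfan_singular.
Qed.

Lemma kyfan_singular_unitary_le U V X : U \is unitarymx -> V \is unitarymx ->
  kyfan_singular (U *m X *m V) <= kyfan_singular X.
Proof.
move=> U_unit V_unit; apply: kyfan_singular_le => P Q P_unit Q_unit.
rewrite (_ : _ *m Q = (P *m U) *m X *m (V *m Q)); last by rewrite !mulmxA.
apply: abs_diag_sum_le_kyfan_singular; first exact: mul_unitarymx P_unit U_unit.
exact: mul_unitarymx V_unit Q_unit.
Qed.

Lemma kyfan_singular_unitary U V X : U \is unitarymx -> V \is unitarymx ->
  kyfan_singular (U *m X *m V) = kyfan_singular X.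
Proof.
move=> U_unit V_unit; apply/le_anti/andP; split; first exact: kyfan_singular_unitary_le.
have := kyfan_singular_unitary_le (U *m X *m V)
  (unitary_adj U_unit) (unitary_adj V_unit).
rewrite !mulmxA (unitary_adj_mul U_unit) mul1mx.
by rewrite -mulmxA (unitary_mul_adj V_unit) mulmx1.
Qed.

Lemma kyfan_singular_symmetric : symmetric_norm kyfan_singular.
Proof.
split; [exact: kyfan_singular_ge0 | exact: kyfan_singular0_eq0 |
  exact: kyfan_singularZ | exact: kyfan_singularD | exact: kyfan_singular_unitary].
Qed.

Lemma diag_sum_le_kyfan_norm A U : adj A = A -> U \is unitarymx ->
  diag_sum k (adjconj U A) <= kyfan_norm k A.
Proof.
move=> /diagonalizes_eig_decr[V dA] U_unit; rewrite kyfan_normE // diag_sum_rediag.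
exact: rediag_prefix_le dA (@eig_decr_nonincr _ _ A) U_unit k.
Qed.

Lemma abs_diag_sum_le_kyfan_norm A U V : psdmx A ->
  U \is unitarymx -> V \is unitarymx ->
  abs_diag_sum k (U *m A *m V) <= kyfan_norm k A.
Proof.
move=> A_psd U_unit V_unit; have A_herm := A_psd.1.
have le_UU := diag_sum_le_kyfan_norm A_herm U_unit.
have le_VV := diag_sum_le_kyfan_norm A_herm (unitary_adj V_unit).
suff : 2 * abs_diag_sum k (U *m A *m V) <=
    diag_sum k (adjconj U A) + diag_sum k (adjconj (adj V) A) by lra.
rewrite mulr_sumr -big_split; apply: ler_sum => i _.
by rewrite /= !entry_hform !adjK; exact: cabs_hform_le_mean.
Qed.

Lemma kyfan_singular_psdmx A : psdmx A -> kyfan_singular A = kyfan_norm k A.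
Proof.
move=> A_psd; apply/le_anti/andP; split.
  by apply: kyfan_singular_le => U V; exact: abs_diag_sum_le_kyfan_norm.
have [U dA] := diagonalizes_eig_decr A_psd.1; have U_unit := unitary_adj dA.1.
rewrite kyfan_normE // -(diagonalizes_rediag dA) -diag_sum_rediag.
apply: le_trans (diag_sum_le_abs _ _) _.
exact: abs_diag_sum_le_kyfan_singular U_unit (unitary_adj U_unit).
Qed.

End KyFanNorm.

Section SymmetricAntinorms.
Variables (R : realType) (p : nat) (N : 'M[R[i]]_p -> R).
Hypothesis N_anti : symmetric_antinorm N.

Lemma antinorm_sym_incr_concave :
  sym_incr_concave (fun u => 0 <= u) (fun x => N (diagR x)).
Proof.
case: N_anti => N_ge0 _ N_hom N_unit N_add.
split=> [s x /psdmx_diagR x_psd|x y /psdmx_diagR x_psd _ le_xy|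
         x y t /psdmx_diagR x_psd /psdmx_diagR y_psd /andP[t_ge0 t_le1]].
- by rewrite -adjconj_perm_diagR; apply: N_unit x_psd; exact: unitary_perm_mx.
- have yx_psd : psdmx (diagR (y - x)).
    by apply/psdmx_diagR => i; rewrite !mxE subr_ge0.
  rewrite -[y](subrK x) addrC diagRD.
  by apply: le_trans (N_add _ _ x_psd yx_psd); rewrite lerDl N_ge0.
- have t'_ge0 : 0 <= 1 - t by rewrite subr_ge0.
  rewrite diagRD !diagRZ -!N_hom //; apply: N_add; exact: psdmxZ.
Qed.

Lemma antinorm_eig_incr A : psdmx A -> N A = N (diagR (eig_incr A)).
Proof.
move=> A_psd; have [U [U_unit {1}->]] := diagonalizes_eig_incr A_psd.1.
by case: N_anti => _ _ _ N_unit _; apply/N_unit/psdmx_diagR/eig_incr_ge0.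
Qed.

End SymmetricAntinorms.

Section SymmetricNorms.
Variables (R : realType) (p : nat) (N : 'M[R[i]]_p -> R).
Hypothesis N_norm : symmetric_norm N.
Implicit Types (A U X : 'M[R[i]]_p) (d r x y : 'rV[R]_p) (t : R).

Lemma norm_diagR_contraction r X :
  (forall i, `|r 0 i| <= 1) -> N (diagR r *m X) <= N X.
Proof.
case: N_norm => _ _ N_hom N_add N_unit /diagR_half_sum_unitary[D D_unit ->].
have N_mulU U : U \is unitarymx -> N (U *m X) = N X.
  by move=> U_unit; have := N_unit U 1%:M X U_unit (unitary1 R p); rewrite mulmx1.
rewrite -scalemxAl mulmxDl N_hom cabs_cR ?invr_ge0 ?ler0n // ler_pdivrMl ?ltr0n //.
rewrite mulr_natl mulr2n; apply: (le_trans (N_add _ _)).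
by rewrite (N_mulU D D_unit) (N_mulU _ (unitary_adj D_unit)).
Qed.

Lemma norm_diagR_le x y : (forall i, 0 <= x 0 i <= y 0 i) ->
  N (diagR x) <= N (diagR y).
Proof.
move=> xy; have -> : diagR x = diagR (\row_i (x 0 i / y 0 i)) *m diagR y.
  rewrite diagRM; congr diagR; apply/rowP => i; rewrite !mxE.
  have /andP[x_ge0 le_xy] := xy i; have [y0|y_neq0] := eqVneq (y 0 i) 0.
    by apply/le_anti; rewrite y0 mulr0 x_ge0 -y0 le_xy.
  by rewrite divfK.
apply: norm_diagR_contraction => i; rewrite mxE.
have /andP[x_ge0 le_xy] := xy i; have y_ge0 := le_trans x_ge0 le_xy.
rewrite ger0_norm ?divr_ge0 //.
have [->|y_neq0] := eqVneq (y 0 i) 0; first by rewrite invr0 mulr0 ler01.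
by rewrite ler_pdivrMr ?mul1r // lt_def y_neq0.
Qed.

Lemma norm_diagR_perm s x : N (diagR (col_perm s x)) = N (diagR x).
Proof.
case: N_norm => _ _ _ _ N_unit; have s_unit := unitary_perm_mx R s.
by rewrite -adjconj_perm_diagR; apply: N_unit s_unit (unitary_adj s_unit).
Qed.

Lemma norm_diagR_comb t x y : 0 <= t <= 1 ->
  N (diagR (t *: x + (1 - t) *: y)) <= t * N (diagR x) + (1 - t) * N (diagR y).
Proof.
case: N_norm => _ _ N_hom N_add _ /andP[t_ge0 t_le1].
rewrite diagRD !diagRZ; apply: (le_trans (N_add _ _)).
by rewrite !N_hom !cabs_cR // subr_ge0.
Qed.

Lemma norm_sym_incr_convex :
  sym_incr_convex (fun u => 0 <= u) (fun x => N (diagR x)).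
Proof.
split=> [s x _|x y x_ge0 _ le_xy|x y t _ _].
- exact: norm_diagR_perm.
- by apply: norm_diagR_le => i; rewrite x_ge0 le_xy.
- exact: norm_diagR_comb.
Qed.

Lemma norm_inv_sym_incr_concave :
  sym_incr_concave (fun u => 0 < u) (fun x => - N (diagR (map_mx GRing.inv x))).
Proof.
split=> [s x _|x y x_gt0 y_gt0 le_xy|x y t x_gt0 y_gt0 t01].
- by rewrite map_col_perm norm_diagR_perm.
- rewrite lerN2; apply: norm_diagR_le => i; rewrite !mxE.
  by rewrite invr_ge0 ltW //= lef_pV2 ?posrE.
- rewrite !mulrN -opprD lerN2; apply: le_trans (norm_diagR_comb _ _ t01).
  apply: norm_diagR_le => i; rewrite !mxE invr_convex_gt0 // invr_ge0 ltW //.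
  exact: convex_pred_gt0.
Qed.

Lemma norm_diagonalizes U d A : diagonalizes U d A -> N A = N (diagR d).
Proof.
case: N_norm => _ _ _ _ N_unit [U_unit ->].
exact: N_unit U_unit (unitary_adj U_unit).
Qed.

Lemma norm_eig_decr A : adj A = A -> N A = N (diagR (eig_decr A)).
Proof. by move=> /diagonalizes_eig_decr[U dA]; exact: norm_diagonalizes dA. Qed.

Lemma norm_invmx A : pdmx A -> N (invmx A) = N (diagR (map_mx GRing.inv (eig_incr A))).
Proof. by move=> /diagonalizes_invmx_eig_incr[U dA]; exact: norm_diagonalizes dA. Qed.

End SymmetricNorms.

Section Comparisons.
Variables (R : realType) (l : nat).
Implicit Types (g : 'M[R[i]]_l -> R).
Variables (X Y1 Y2 : 'M[R[i]]_l) (t : R).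

Definition concave_at g := t * g Y1 + (1 - t) * g Y2 <= g X.
Definition convex_at g := g X <= t * g Y1 + (1 - t) * g Y2.

Definition kyfan_antinorms_concave_at :=
  forall k, (1 <= k <= l)%N -> concave_at (kyfan_antinorm k).
Definition kyfan_norms_convex_at :=
  forall k, (1 <= k <= l)%N -> convex_at (kyfan_norm k).

Lemma kyfan_antinorm_prefix_le :
  kyfan_antinorms_concave_at ->
  prefix_le (t *: eig_incr Y1 + (1 - t) *: eig_incr Y2) (eig_incr X).
Proof.
move=> X_concave; apply: prefix_le_bounded => k /[dup] k_bounds /andP[_ le_kl].
have := X_concave k k_bounds.
by rewrite /concave_at !kyfan_antinormE // linearD !scalarZ.
Qed.

Lemma kyfan_norm_prefix_le :
  kyfan_norms_convex_at ->
  prefix_le (eig_decr X) (t *: eig_decr Y1 + (1 - t) *: eig_decr Y2).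
Proof.
move=> X_convex; apply: prefix_le_bounded => k /[dup] k_bounds /andP[_ le_kl].
have := X_convex k k_bounds.
by rewrite /convex_at !kyfan_normE // linearD !scalarZ.
Qed.

Hypothesis t01 : 0 <= t <= 1.

Lemma kyfan_concave_antinorm N : psdmx X -> psdmx Y1 -> psdmx Y2 ->
  kyfan_antinorms_concave_at -> symmetric_antinorm N -> concave_at N.
Proof.
move=> X_psd Y1_psd Y2_psd /kyfan_antinorm_prefix_le le_X N_anti; rewrite /concave_at.
rewrite (antinorm_eig_incr N_anti X_psd) (antinorm_eig_incr N_anti Y1_psd).
rewrite (antinorm_eig_incr N_anti Y2_psd).
exact: (sym_incr_concave_comb (@convex_pred_ge0 R) (antinorm_sym_incr_concave N_anti)
  (eig_incr_ge0 X_psd) (eig_incr_ge0 Y1_psd) (eig_incr_ge0 Y2_psd) t01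
  (@eig_incr_nondecr _ _ X) le_X).
Qed.

Lemma kyfan_convex_norm N : psdmx X -> psdmx Y1 -> psdmx Y2 ->
  kyfan_norms_convex_at -> symmetric_norm N -> convex_at N.
Proof.
move=> X_psd Y1_psd Y2_psd /kyfan_norm_prefix_le le_X N_norm; rewrite /convex_at.
rewrite (norm_eig_decr N_norm X_psd.1) (norm_eig_decr N_norm Y1_psd.1).
rewrite (norm_eig_decr N_norm Y2_psd.1).
exact: (sym_incr_convex_comb (@convex_pred_ge0 R) (norm_sym_incr_convex N_norm)
  (eig_decr_ge0 X_psd) (eig_decr_ge0 Y1_psd) (eig_decr_ge0 Y2_psd) t01
  (@eig_decr_nonincr _ _ X) le_X).
Qed.

Hypotheses (X_pd : pdmx X) (Y1_pd : pdmx Y1) (Y2_pd : pdmx Y2).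

Lemma kyfan_concave_norm_invmx N :
  kyfan_antinorms_concave_at -> symmetric_norm N -> convex_at (fun Y => N (invmx Y)).
Proof.
move=> /kyfan_antinorm_prefix_le le_X N_norm; rewrite /convex_at.
rewrite (norm_invmx N_norm X_pd) (norm_invmx N_norm Y1_pd) (norm_invmx N_norm Y2_pd).
rewrite -lerN2 opprD -!mulrN.
exact: (sym_incr_concave_comb (@convex_pred_gt0 R) (norm_inv_sym_incr_concave N_norm)
  (eig_incr_gt0 X_pd) (eig_incr_gt0 Y1_pd) (eig_incr_gt0 Y2_pd) t01
  (@eig_incr_nondecr _ _ X) le_X).
Qed.

Lemma kyfan_concave_trf f :
  kyfan_antinorms_concave_at -> nondecr_pos f -> concave_pos f -> concave_at (trf f).
Proof.
move=> /kyfan_antinorm_prefix_le le_X f_incr f_concave.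
have sum_f : sym_incr_concave (fun u => 0 < u) (fun x : 'rV_l => \sum_i f (x 0 i)).
  by apply: sum_sym_incr_concave f_concave => u v u_gt0 _; exact: f_incr.
rewrite /concave_at !trf_eig_incr.
exact: (sym_incr_concave_comb (@convex_pred_gt0 R) sum_f
  (eig_incr_gt0 X_pd) (eig_incr_gt0 Y1_pd) (eig_incr_gt0 Y2_pd) t01
  (@eig_incr_nondecr _ _ X) le_X).
Qed.

Lemma kyfan_convex_trf f :
  kyfan_norms_convex_at -> nondecr_pos f -> convex_pos f -> convex_at (trf f).
Proof.
move=> /kyfan_norm_prefix_le le_X f_incr f_convex.
have sum_f : sym_incr_convex (fun u => 0 < u) (fun x : 'rV_l => \sum_i f (x 0 i)).
  by apply: sum_sym_incr_convex f_convex => u v u_gt0 _; exact: f_incr.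
rewrite /convex_at !trf_eig_decr.
exact: (sym_incr_convex_comb (@convex_pred_gt0 R) sum_f
  (eig_decr_gt0 X_pd) (eig_decr_gt0 Y1_pd) (eig_decr_gt0 Y2_pd) t01
  (@eig_decr_nonincr _ _ X) le_X).
Qed.

Lemma concave_trf_invmx f :
  concave_at (trf (fun u => - f u^-1)) -> convex_at (fun Y => trf f (invmx Y)).
Proof.
rewrite /convex_at (trf_invmx _ X_pd) (trf_invmx _ Y1_pd) (trf_invmx _ Y2_pd).
by rewrite /concave_at !trfN !mulrN -opprD lerN2.
Qed.

End Comparisons.

Section InverseArgument.
Variables (R : realType) (f : R -> R).

Lemma nondecr_pos_oppr_inv : nondecr_pos f -> nondecr_pos (fun u => - f u^-1).
Proof.
move=> f_incr u v u_gt0 le_uv; have v_gt0 := lt_le_trans u_gt0 le_uv.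
by rewrite lerN2; apply: f_incr; rewrite ?invr_gt0 // lef_pV2.
Qed.

Lemma concave_pos_oppr_inv :
  nondecr_pos f -> convex_pos f -> concave_pos (fun u => - f u^-1).
Proof.
move=> f_incr f_convex u v t u_gt0 v_gt0 t01; rewrite !mulrN -opprD lerN2.
apply: le_trans (f_convex _ _ _ _ _ t01); rewrite ?invr_gt0 //.
by apply: f_incr; [rewrite invr_gt0 convex_pred_gt0 | exact: invr_convex_gt0].
Qed.

End InverseArgument.

Section JointConcavity.
Variables (R : realType) (n m l : nat).
Variable F : 'M[R[i]]_n -> 'M[R[i]]_m -> 'M[R[i]]_l.
Hypothesis F_pd : forall A B, pdmx A -> pdmx B -> pdmx (F A B).
Implicit Types (g N : 'M[R[i]]_l -> R) (f : R -> R).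

Variant image_comb : 'M[R[i]]_l -> 'M[R[i]]_l -> 'M[R[i]]_l -> R -> Prop :=
  ImageComb A1 A2 B1 B2 t of pdmx A1 & pdmx A2 & pdmx B1 & pdmx B2 & 0 <= t <= 1 :
    image_comb (F (cR t *: A1 + cR (1 - t) *: A2) (cR t *: B1 + cR (1 - t) *: B2))
      (F A1 B1) (F A2 B2) t.

Lemma jointly_concaveP g : jointly_concave (fun A B => g (F A B)) <->
  forall X Y1 Y2 t, image_comb X Y1 Y2 t -> concave_at X Y1 Y2 t g.
Proof.
split=> [g_concave _ _ _ _ []|g_concave A1 A2 B1 B2 t]; first exact: g_concave.
move=> A1_pd A2_pd B1_pd B2_pd t01.
exact: g_concave (ImageComb A1_pd A2_pd B1_pd B2_pd t01).
Qed.

Lemma jointly_convexP g : jointly_convex (fun A B => g (F A B)) <->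
  forall X Y1 Y2 t, image_comb X Y1 Y2 t -> convex_at X Y1 Y2 t g.
Proof.
split=> [g_convex _ _ _ _ []|g_convex A1 A2 B1 B2 t]; first exact: g_convex.
move=> A1_pd A2_pd B1_pd B2_pd t01.
exact: g_convex (ImageComb A1_pd A2_pd B1_pd B2_pd t01).
Qed.

Lemma image_comb_pdmx X Y1 Y2 t :
  image_comb X Y1 Y2 t -> [/\ pdmx X, pdmx Y1, pdmx Y2 & 0 <= t <= 1].
Proof.
move=> [A1 A2 B1 B2 {}t A1_pd A2_pd B1_pd B2_pd t01].
split; [|exact: F_pd|exact: F_pd|exact: t01].
exact: F_pd (pdmx_comb A1_pd A2_pd t01) (pdmx_comb B1_pd B2_pd t01).
Qed.

Definition kyfan_antinorms_concave := forall k, (1 <= k <= l)%N ->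
  jointly_concave (fun A B => kyfan_antinorm k (F A B)).

Definition kyfan_norms_convex := forall k, (1 <= k <= l)%N ->
  jointly_convex (fun A B => kyfan_norm k (F A B)).

Lemma image_comb_kyfan_antinorms X Y1 Y2 t :
  kyfan_antinorms_concave -> image_comb X Y1 Y2 t ->
  kyfan_antinorms_concave_at X Y1 Y2 t.
Proof. by move=> F_concave XY k /F_concave/jointly_concaveP; apply. Qed.

Lemma image_comb_kyfan_norms X Y1 Y2 t :
  kyfan_norms_convex -> image_comb X Y1 Y2 t -> kyfan_norms_convex_at X Y1 Y2 t.
Proof. by move=> F_convex XY k /F_convex/jointly_convexP; apply. Qed.

Lemma jointly_concave_antinorm N :
  kyfan_antinorms_concave -> symmetric_antinorm N ->
  jointly_concave (fun A B => N (F A B)).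
Proof.
move=> F_concave N_anti; apply/jointly_concaveP => X Y1 Y2 t XY.
have [X_pd Y1_pd Y2_pd t01] := image_comb_pdmx XY.
have kyfan_at := image_comb_kyfan_antinorms F_concave XY.
exact: (kyfan_concave_antinorm t01 (pdmx_psdmx X_pd) (pdmx_psdmx Y1_pd)
  (pdmx_psdmx Y2_pd) kyfan_at N_anti).
Qed.

Lemma jointly_concave_trf f :
  kyfan_antinorms_concave -> nondecr_pos f -> concave_pos f ->
  jointly_concave (fun A B => trf f (F A B)).
Proof.
move=> F_concave f_incr f_concave; apply/jointly_concaveP => X Y1 Y2 t XY.
have [X_pd Y1_pd Y2_pd t01] := image_comb_pdmx XY.
have kyfan_at := image_comb_kyfan_antinorms F_concave XY.
exact: (kyfan_concave_trf t01 X_pd Y1_pd Y2_pd kyfan_at f_incr f_concave).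
Qed.

Lemma jointly_convex_norm_invmx N :
  kyfan_antinorms_concave -> symmetric_norm N ->
  jointly_convex (fun A B => N (invmx (F A B))).
Proof.
move=> F_concave N_norm.
apply/(jointly_convexP (fun Y => N (invmx Y))) => X Y1 Y2 t XY.
have [X_pd Y1_pd Y2_pd t01] := image_comb_pdmx XY.
have kyfan_at := image_comb_kyfan_antinorms F_concave XY.
exact: (kyfan_concave_norm_invmx t01 X_pd Y1_pd Y2_pd kyfan_at N_norm).
Qed.

Lemma jointly_convex_norm N :
  kyfan_norms_convex -> symmetric_norm N -> jointly_convex (fun A B => N (F A B)).
Proof.
move=> F_convex N_norm; apply/jointly_convexP => X Y1 Y2 t XY.
have [X_pd Y1_pd Y2_pd t01] := image_comb_pdmx XY.
have kyfan_at := image_comb_kyfan_norms F_convex XY.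
exact: (kyfan_convex_norm t01 (pdmx_psdmx X_pd) (pdmx_psdmx Y1_pd)
  (pdmx_psdmx Y2_pd) kyfan_at N_norm).
Qed.

Lemma jointly_convex_trf f :
  kyfan_norms_convex -> nondecr_pos f -> convex_pos f ->
  jointly_convex (fun A B => trf f (F A B)).
Proof.
move=> F_convex f_incr f_convex; apply/jointly_convexP => X Y1 Y2 t XY.
have [X_pd Y1_pd Y2_pd t01] := image_comb_pdmx XY.
have kyfan_at := image_comb_kyfan_norms F_convex XY.
exact: (kyfan_convex_trf t01 X_pd Y1_pd Y2_pd kyfan_at f_incr f_convex).
Qed.

Lemma symmetric_norms_kyfan_norms_convex :
  (forall N, symmetric_norm N -> jointly_convex (fun A B => N (F A B))) ->
  kyfan_norms_convex.
Proof.
move=> F_convex k k_bounds; apply/jointly_convexP => X Y1 Y2 t XY.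
have [/pdmx_psdmx X_psd /pdmx_psdmx Y1_psd /pdmx_psdmx Y2_psd _] := image_comb_pdmx XY.
have := kyfan_singular_symmetric R k_bounds.
move=> /F_convex/jointly_convexP/(_ _ _ _ _ XY); rewrite /convex_at.
by rewrite !(kyfan_singular_psdmx k_bounds).
Qed.

Lemma jointly_convex_trf_invmx f :
  jointly_concave (fun A B => trf (fun u => - f u^-1) (F A B)) ->
  jointly_convex (fun A B => trf f (invmx (F A B))).
Proof.
move=> /jointly_concaveP F_concave.
apply/(jointly_convexP (fun Y => trf f (invmx Y))) => X Y1 Y2 t XY.
have [X_pd Y1_pd Y2_pd t01] := image_comb_pdmx XY.
by apply: concave_trf_invmx => //; exact: F_concave XY.
Qed.

End JointConcavity.

Theorem theorem4p1 (R : realType) (n m l : nat)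
  (F : 'M[R[i]]_n -> 'M[R[i]]_m -> 'M[R[i]]_l)
  (HF : forall A B, pdmx A -> pdmx B -> pdmx (F A B)) :
  let cond_a := forall N : 'M[R[i]]_l -> R, symmetric_antinorm N ->
      jointly_concave (fun A B => N (F A B)) in
  let cond_a' := forall k : nat, (1 <= k <= l)%N ->
      jointly_concave (fun A B => kyfan_antinorm k (F A B)) in
  let cond_b := forall N : 'M[R[i]]_l -> R, symmetric_norm N ->
      jointly_convex (fun A B => N (invmx (F A B))) in
  let cond_b' := forall k : nat, (1 <= k <= l)%N ->
      jointly_convex (fun A B => kyfan_norm k (invmx (F A B))) in
  let cond_c := forall f : R -> R, nondecr_pos f -> concave_pos f ->
      jointly_concave (fun A B => trf f (F A B)) in
  let cond_d := forall f : R -> R, nondecr_pos f -> convex_pos f ->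
      jointly_convex (fun A B => trf f (invmx (F A B))) in
  ((cond_a <-> cond_a') /\ (cond_a' -> cond_b) /\ (cond_b <-> cond_b') /\
   (cond_b' -> cond_d)) /\ ((cond_a -> cond_c) /\ (cond_c -> cond_d)).
Proof.
move=> cond_a cond_a' cond_b cond_b' cond_c cond_d.
have Finv_pd A B (A_pd : pdmx A) (B_pd : pdmx B) := pdmx_invmx (HF _ _ A_pd B_pd).
have aa' : cond_a -> cond_a'.
  by move=> a k /andP[_ le_kl]; exact: a (kyfan_antinorm_symmetric R le_kl).
have a'a : cond_a' -> cond_a by move=> a' N; exact: jointly_concave_antinorm.
have a'b : cond_a' -> cond_b by move=> a' N; exact: jointly_convex_norm_invmx.
have bb' : cond_b -> cond_b' by exact: symmetric_norms_kyfan_norms_convex.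
have b'b : cond_b' -> cond_b by move=> b' N; exact: jointly_convex_norm.
have b'd : cond_b' -> cond_d by move=> b' f; exact: jointly_convex_trf.
have a'c : cond_a' -> cond_c by move=> a' f; exact: jointly_concave_trf.
have cd : cond_c -> cond_d.
  move=> c f f_incr f_convex; apply: (jointly_convex_trf_invmx HF).
  exact: c (nondecr_pos_oppr_inv f_incr) (concave_pos_oppr_inv f_incr f_convex).
by split; [split | split=> // a; exact/a'c/aa'].
Qed.
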